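(* Let $m\in\mathbb{C}$ not be a negative integer, let $m'\ge 0$ be an integer and let $n\ge 1$ be an integer. Then, for $x>0$, $$\int x^m(\ln x)^{m'}\,d^nx=\frac{(m')!\,\Gamma(m+1)\,x^{n+m}}{\Gamma(n+m+1)}\left[\sum_{k=0}^{m'}(-1)^{m'-k}\frac{(\ln x)^k}{k!}\sum_{\sum i\,y_i=m'-k}\ \prod_{i=1}^{m'-k}\frac{1}{y_i!\,i^{y_i}}\left(\sum_{N=1+m}^{n+m}\frac{1}{N^i}\right)^{y_i}\right]+C_n(x),$$ where the sum over $\sum i\,y_i=m'-k$ runs over all partitions of $m'-k$ and $C_n(x)=\sum_{i=0}^{n-1}c_i\frac{x^i}{i!}$ with arbitrary constants of integration $c_0,\dots,c_{n-1}$.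
   Context: $\int g(x)\,d^nx$ denotes the $n$-fold indefinite integral $\int\cdots\int g(x)\,dx\cdots dx$ ($n$ integral signs), i.e. the family of all functions on $(0,\infty)$ whose $n$-th derivative is $g$; the equality says that this family consists exactly of the functions on the right as the constants $c_i$ vary. $\Gamma$ is the gamma function and $x^m=e^{m\ln x}$. For complex $m$, $\sum_{N=1+m}^{n+m}\frac{1}{N^i}$ means $\sum_{r=1}^{n}\frac{1}{(m+r)^i}$. A partition of a non-negative integer $M$ is represented by the tuple $(y_1,\dots,y_M)$ of non-negative integers with $\sum_{i=1}^{M}i\,y_i=M$ ($y_i$ is the multiplicity of the part $i$); for $M=0$ there is exactly one (empty) partition and the corresponding product equals $1$. Convention: $z^0=1$. *)

(* Defs.v *)
From mathcomp Require Import all_boot.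
From Stdlib Require Import Reals Factorial.
From Coquelicot Require Import Coquelicot.

Set Implicit Arguments.
Unset Strict Implicit.
Unset Printing Implicit Defensive.

Local Open Scope R_scope.
Local Open Scope C_scope.

Notation "\Csum_ ( i < n ) F" := (\big[Cplus/RtoC 0]_(i < n) F)
  (at level 41, i, n at level 50, F at level 41) : C_scope.
Notation "\Cprod_ ( i < n ) F" := (\big[Cmult/RtoC 1]_(i < n) F)
  (at level 36, i, n at level 50, F at level 36) : C_scope.

Definition Cexp (z : C) : C :=
  (exp (fst z) * cos (snd z), exp (fst z) * sin (snd z))%R.

(* [Cpowr x z] is x^z for x > 0. *)
Definition Cpowr (x : R) (z : C) : C := Cexp (z * ln x).

Definition CLim_seq (u : nat -> C) : C :=
  (real (Lim_seq (fun k => fst (u k))), real (Lim_seq (fun k => snd (u k)))).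

(* Euler's limit formula, valid for every z which is not a non-positive
   integer:  Gamma z = lim_k  k! k^z / (z (z + 1) ... (z + k)). *)
Definition Gamma (z : C) : C :=
  CLim_seq (fun k => INR (fact k) * Cpowr (INR k) z
                     / \Cprod_(j < k.+1) (z + INR j)).

(* The n-th derivative of F exists and equals g on (0, +oo); the values of F
   and g outside (0, +oo) are irrelevant. *)
Fixpoint is_nth_derive_pos (n : nat) (F g : R -> C) : Prop :=
  match n with
  | O => forall x : R, (0 < x)%R -> F x = g x
  | S n' => exists F' : R -> C,
      (forall x : R, (0 < x)%R ->
         @is_derive R_AbsRing C_R_NormedModule F x (F' x)) /\
      is_nth_derive_pos n' F' g
  end.

(* In a partition of M the multiplicity [y i] is that of the part i + 1, the
   parts being 1, ..., M; every multiplicity is at most M, so taking values in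
   'I_M.+1 loses no partition. *)
Definition is_partition (M : nat) (y : {ffun 'I_M -> 'I_M.+1}) : bool :=
  (\sum_(i < M) i.+1 * y i)%nat == M.

Definition partition_sum (M : nat) (p : nat -> C) : C :=
  \big[Cplus/RtoC 0]_(y : {ffun 'I_M -> 'I_M.+1} | is_partition y)
    \Cprod_(i < M)
      (1 / (INR (fact (y i)) * INR i.+1 ^ y i) * p i.+1 ^ y i).

(* The sum of 1 / N^i for N = 1 + m, ..., n + m. *)
Definition shifted_power_sum (n : nat) (m : C) (i : nat) : C :=
  \Csum_(r < n) (1 / (m + INR r.+1) ^ i).

(* Main.v *)
(** Write x_r = 1/(m + r). By Newton's identities, the sum over the partitions
    of M is the complete homogeneous symmetric polynomial h_M(x_1, ..., x_n),
    because its i-th argument is the power sum p_i(x_1, ..., x_n). Hence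
    h_{M+1}(n+1) = h_{M+1}(n) + x_{n+1} h_M(n+1), which says exactly that the
    derivative of the right-hand side for n+1 is the right-hand side for n; and
    two functions with the same derivative on (0, +oo) differ by a constant.
    The gamma quotient is 1 / ((m+1) ... (m+n)): this needs the convergence of
    Euler's limit to a nonzero value, obtained from the absolute convergence of
    the infinite product of (1 + z h) (1 - h)^z = 1 + O(h^2), h = 1/(k+1). *)

Require Import Defs.
From HB Require Import structures.
From mathcomp Require Import all_boot.
From Stdlib Require Import Reals Factorial Lra.
From Coquelicot Require Import Coquelicot.
Local Open Scope C_scope.

(** * Partition sums *)

HB.instance Definition _ :=
  Monoid.isComLaw.Build C (RtoC 0) Cplus Cplus_assoc Cplus_comm Cplus_0_l.
HB.instance Definition _ :=
  Monoid.isComLaw.Build C (RtoC 1) Cmult Cmult_assoc Cmult_comm Cmult_1_l.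
HB.instance Definition _ :=
  Monoid.isMulLaw.Build C (RtoC 0) Cmult Cmult_0_l Cmult_0_r.
HB.instance Definition _ :=
  Monoid.isAddLaw.Build C Cmult Cplus Cmult_plus_distr_r Cmult_plus_distr_l.

Lemma RtoC_INR_S n : RtoC (INR n.+1) = RtoC (INR n) + 1.
Proof. by rewrite S_INR RtoC_plus. Qed.

Lemma RtoC_INR_neq0 n : RtoC (INR n.+1) <> 0.
Proof. by move=> h; apply: (not_0_INR n.+1) => //; apply: RtoC_inj. Qed.

Lemma fact_INR_neq0 n : RtoC (INR (fact n)) <> 0.
Proof. by move=> h; apply: (INR_fact_neq_0 n); apply: RtoC_inj. Qed.

Lemma RtoC_INR_sum (I : finType) (P : pred I) (f : I -> nat) :
  RtoC (INR (\sum_(i | P i) f i)%nat)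
  = \big[Cplus/RtoC 0]_(i | P i) RtoC (INR (f i)).
Proof.
apply: (big_morph (fun n => RtoC (INR n))) => [x y|] //.
by rewrite plus_INR RtoC_plus.
Qed.

(** Extending by 0 to every natural index lets partitions of [M] and of [M - i.+1], whose index
    types differ, be compared at the same [j]. *)
Definition multiplicity {M K} (y : {ffun 'I_M -> 'I_K}) (j : nat) : nat :=
  oapp (fun i => y i : nat) 0%nat (insub j).

Lemma multiplicityE {M K} (y : {ffun 'I_M -> 'I_K}) (i : 'I_M) :
  multiplicity y i = y i.
Proof. by rewrite /multiplicity valK. Qed.

Lemma multiplicity0 {M K} (y : {ffun 'I_M -> 'I_K}) j :
  (M <= j)%nat -> multiplicity y j = 0%nat.
Proof. by move=> h; rewrite /multiplicity insubN // -leqNgt. Qed.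

Definition part_weight (p : nat -> C) (i k : nat) : C :=
  1 / (RtoC (INR (fact k)) * RtoC (INR i.+1) ^ k) * p i.+1 ^ k.

Lemma part_weight0 p i : part_weight p i 0 = 1.
Proof. rewrite /part_weight /=. field. Qed.

(** The factor [i.+1 * k.+1] is what the part [i.+1], taken [k.+1] times, contributes to [M]; it
    cancels exactly the new denominators, so one copy of the part is traded for [p i.+1]. *)
Lemma part_weightS p i k :
  RtoC (INR (i.+1 * k.+1)%nat) * part_weight p i k.+1 = p i.+1 * part_weight p i k.
Proof.
rewrite /part_weight /fact -/fact !mult_INR !RtoC_mult.
have -> : forall c : C, c ^ k.+1 = c * c ^ k by [].
have -> : forall c : C, c ^ k.+1 = c * c ^ k by [].
have h1 := RtoC_INR_neq0 k; have h2 := RtoC_INR_neq0 i; have h3 := fact_INR_neq0 k.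
have h4 := Cpow_nz _ k h2.
by field.
Qed.

(** Multiplicities vanish from [M] on, so any larger range gives the same sum; partitions of
    different integers thus share one range. *)
Lemma is_partition_nat {M N} (y : {ffun 'I_M -> 'I_M.+1}) : (M <= N)%nat ->
  is_partition y = ((\sum_(0 <= j < N) j.+1 * multiplicity y j)%nat == M).
Proof.
move=> hMN; rewrite /is_partition (big_cat_nat (n := M)) //= [X in (_ + X)%nat]big1_seq => [|j].
  by rewrite addn0 big_mkord; congr (_ == _); apply: eq_bigr => i _; rewrite multiplicityE.
by rewrite andTb mem_index_iota => /andP [hj _]; rewrite multiplicity0 ?muln0.
Qed.

Lemma part_weight_prod_nat p {M N} (y : {ffun 'I_M -> 'I_M.+1}) : (M <= N)%nat ->
  \Cprod_(i < M) (1 / (RtoC (INR (fact (y i))) * RtoC (INR i.+1) ^ y i) * p i.+1 ^ y i)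
  = \big[Cmult/RtoC 1]_(0 <= j < N) part_weight p j (multiplicity y j).
Proof.
move=> hMN; rewrite (big_cat_nat (n := M)) //= [X in _ = _ * X]big1_seq => [|j].
  by rewrite Cmult_1_r big_mkord; apply: eq_bigr => i _; rewrite multiplicityE.
by rewrite andTb mem_index_iota => /andP [hj _]; rewrite multiplicity0 ?part_weight0.
Qed.

(** Adds one copy of the part [i.+1]. The value never exceeds [M], so [inord] does not alter it. *)
Definition insert_part {M} (i : 'I_M) (y : {ffun 'I_(M - i.+1) -> 'I_(M - i.+1).+1}) :
    {ffun 'I_M -> 'I_M.+1} :=
  [ffun j : 'I_M => inord (multiplicity y j + (j == i))%nat].

Definition remove_part {M} (i : 'I_M) (y : {ffun 'I_M -> 'I_M.+1}) :
    {ffun 'I_(M - i.+1) -> 'I_(M - i.+1).+1} :=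
  [ffun j : 'I_(M - i.+1) => inord (multiplicity y j - (j == i :> nat))%nat].

Lemma multiplicity_insert M (i : 'I_M) y j :
  multiplicity (insert_part i y) j = (multiplicity y j + (j == i))%nat.
Proof.
case: (ltnP j M) => [hj|hj].
  rewrite (multiplicityE (insert_part i y) (Ordinal hj)) ffunE inordK //=.
  rewrite /multiplicity; case: insubP => [k _ _|_] /=.
    have := ltn_ord (y k); case: (_ == _); rewrite /= ltnS => h.
      by rewrite addn1 ltnS (leq_ltn_trans h) // ltn_subrL (leq_ltn_trans _ (ltn_ord i)).
    by rewrite addn0 ltnS (leq_trans h) // leq_subr.
  by case: (_ == _) => //=; rewrite ltnS; apply: leq_ltn_trans (ltn_ord i).
rewrite !multiplicity0 //; last by rewrite (leq_trans _ hj) ?leq_subr.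
by rewrite gtn_eqF // (leq_trans (ltn_ord i) hj).
Qed.

Lemma multiplicity_le M (y : {ffun 'I_M -> 'I_M.+1}) j : is_partition y ->
  (j.+1 * multiplicity y j <= M)%nat.
Proof.
move=> /eqP hy; case: (ltnP j M) => [hj|hj]; last by rewrite multiplicity0 ?muln0.
rewrite (multiplicityE y (Ordinal hj)) -[X in (_ <= X)%nat]hy (bigD1 (Ordinal hj)) //=.
exact: leq_addr.
Qed.

(** Shrinking the index set and the bound loses nothing here: once one copy of [i.+1] is set aside,
    the remaining copies of any part fit into [M - i.+1]. *)
Lemma multiplicity_remove M (i : 'I_M) y j : is_partition y -> (0 < y i)%nat ->
  multiplicity (remove_part i y) j = (multiplicity y j - (j == i))%nat.
Proof.
move=> hy hyi.
have key : ((i.+1 + j.+1 * (multiplicity y j - (j == i)))%nat <= M)%nat.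
  case: (eqVneq j i) => [->|hji].
    rewrite -{1}[i.+1]muln1 -mulnDr subnKC ?multiplicityE //.
    by rewrite -multiplicityE multiplicity_le.
  case: (ltnP j M) => [hj|hj]; last first.
    by rewrite multiplicity0 // muln0 addn0.
  rewrite subn0 (multiplicityE y (Ordinal hj)) -[X in (_ <= X)%nat](eqP hy) (bigD1 i) //=.
  apply: leq_add; first by rewrite leq_pmulr.
  by rewrite (bigD1 (Ordinal hj)) //=; exact: leq_addr.
have {}key : (j.+1 * (multiplicity y j - (j == i)) <= M - i.+1)%nat.
  by rewrite -(leq_add2l i.+1) subnKC.
case: (ltnP j (M - i.+1)) => [hj|hj].
  rewrite (multiplicityE (remove_part i y) (Ordinal hj)) ffunE inordK //=.
  by rewrite ltnS (leq_trans _ key) // leq_pmull.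
(* A positive remaining multiplicity at [j] would force [j.+1 <= M - i.+1], against [hj]. *)
rewrite multiplicity0 //; apply/esym/eqP; move: key; case: (_ - (j == i))%nat => // k.
by rewrite mulnS => h; have := leq_ltn_trans hj (leq_trans (leq_addr _ _) h); rewrite ltnn.
Qed.

Lemma multiplicity_inj M K (y z : {ffun 'I_M -> 'I_K}) :
  multiplicity y =1 multiplicity z -> y = z.
Proof. by move=> h; apply/ffunP => i; apply: val_inj; rewrite /= -!multiplicityE h. Qed.

Lemma is_partition_insert M (i : 'I_M) y :
  is_partition (insert_part i y) = is_partition y.
Proof.
rewrite !(is_partition_nat (N := M)) ?leq_subr //.
under eq_bigr do rewrite multiplicity_insert mulnDr.
rewrite big_split /= [X in (_ + X)%nat](_ : _ = i.+1).
  by rewrite -[X in _ == X](subnK (ltn_ord i)) eqn_add2r.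
rewrite big_mkord (bigD1 i) //= eqxx muln1 big1 ?addn0 // => j /negbTE hj.
by rewrite [(_ == _)%nat]hj muln0.
Qed.

(* Write [M] as the sum of [i * y_i] over the parts of each partition, then
   remove one part [i] from the partitions that contain it. *)
Lemma partition_sum_newton M p :
  RtoC (INR M) * partition_sum M p
  = \Csum_(i < M) (p i.+1 * partition_sum (M - i.+1) p).
Proof.
pose W (y : {ffun 'I_M -> 'I_M.+1}) :=
  \big[Cmult/RtoC 1]_(0 <= j < M) part_weight p j (multiplicity y j).
have -> : partition_sum M p = \big[Cplus/RtoC 0]_(y | is_partition y) W y.
  by apply: eq_bigr => y _; rewrite (part_weight_prod_nat _ (N := M)).
rewrite big_distrr /=.
transitivity (\big[Cplus/RtoC 0]_(y : {ffun 'I_M -> 'I_M.+1} | is_partition y)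
    \Csum_(i < M) (RtoC (INR (i.+1 * y i)%nat) * W y)).
  by apply: eq_bigr => y /eqP hy; rewrite -{1}hy RtoC_INR_sum big_distrl.
rewrite exchange_big /=; apply: eq_bigr => i _.
(* Partitions without the part [i.+1] carry the factor [y i = 0] and drop out. *)
rewrite (bigID (fun y : {ffun 'I_M -> 'I_M.+1} => (0 < y i)%nat)) /=.
rewrite [X in _ + X]big1 ?Cplus_0_r; last first.
  move=> y /andP [_]; rewrite -eqn0Ngt => /eqP ->.
  by rewrite muln0 /= Cmult_0_l.
(* Insertion is a bijection from the partitions of [M - i.+1] onto the partitions of [M] that
   contain [i.+1]. *)
rewrite (reindex_onto (insert_part i) (remove_part i)) /=; last first.
  move=> y /andP [hy hyi]; apply: multiplicity_inj => j.
  rewrite multiplicity_insert multiplicity_remove // subnK //.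
  by case: eqP => // ->; rewrite multiplicityE.
rewrite big_distrr /=; apply: eq_big => [y|y _].
  rewrite is_partition_insert -(multiplicityE (insert_part i y)) multiplicity_insert.
  rewrite eqxx addn1 andbT; case hy: (is_partition y) => //=.
  apply/eqP/multiplicity_inj => j; rewrite multiplicity_remove ?is_partition_insert //.
    by rewrite multiplicity_insert addnK.
  by rewrite -(multiplicityE (insert_part i y)) multiplicity_insert eqxx addn1.
rewrite (part_weight_prod_nat _ (N := M)) ?leq_subr // /W !big_mkord.
rewrite (bigD1 i) //= [in RHS](bigD1 i) //=.
rewrite -(multiplicityE (insert_part i y)) multiplicity_insert eqxx addn1.
rewrite Cmult_assoc part_weightS -Cmult_assoc; congr Cmult.
congr Cmult; apply: eq_bigr => j /negbTE hj.
by rewrite multiplicity_insert [(_ == _)%nat]hj addn0.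
Qed.

Lemma partition_sum0 p : partition_sum 0 p = 1.
Proof.
rewrite /partition_sum.
have E : forall y : {ffun 'I_0 -> 'I_1}, is_partition y = true.
  by move=> y; rewrite /is_partition big_ord0.
rewrite (eq_bigl _ _ E) (eq_bigr (fun => RtoC 1)); last by move=> y _; rewrite big_ord0.
rewrite (big_pred1 [ffun=> ord0]) // => y.
by apply/esym/eqP/ffunP; case.
Qed.

(* The effect on the complete homogeneous polynomials of one more variable [x]:
   Newton's identities determine [b] from the power sums [p i + x ^ i]. *)
Lemma newton_add (p a b : nat -> C) (x : C) :
  a 0%nat = b 0%nat ->
  (forall M, RtoC (INR M) * a M = \Csum_(i < M) (p i.+1 * a (M - i.+1)%nat)) ->
  (forall M, RtoC (INR M) * b M
             = \Csum_(i < M) ((p i.+1 + x ^ i.+1) * b (M - i.+1)%nat)) ->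
  forall M, b M.+1 = a M.+1 + x * b M.
Proof.
move=> h0 ha hb M; elim/ltn_ind: M => M IH.
suff E : RtoC (INR M.+1) * b M.+1 = RtoC (INR M.+1) * (a M.+1 + x * b M).
  have hN := RtoC_INR_neq0 M.
  have -> : b M.+1 = / RtoC (INR M.+1) * (RtoC (INR M.+1) * b M.+1) by field.
  by rewrite E; field.
(* For [i < M] the induction hypothesis splits [b (M - i)]; the last term involves [b 0 = a 0]. The
   [a] parts reassemble into Newton's identity for [a] at [M.+1]. *)
have Hp : \Csum_(i < M.+1) (p i.+1 * b (M - i)%nat)
     = RtoC (INR M.+1) * a M.+1 + x * \Csum_(i < M) (p i.+1 * b (M - i.+1)%nat).
  rewrite ha !big_ord_recr /= !subnn -h0 big_distrr /=.
  rewrite [RHS](_ : forall u v w, u + v + w = u + w + v) => [|*]; last by ring.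
  congr (_ + _); rewrite -big_split /=; apply: eq_bigr => i _; rewrite subSS.
  have E : (M - i = (M - i.+1).+1)%nat by rewrite subnSK.
  rewrite {1}E IH; last by rewrite -E leq_subr.
  by rewrite -E; ring.
have Hx : \Csum_(i < M.+1) (x ^ i.+1 * b (M - i)%nat)
     = x * b M + x * \Csum_(i < M) (x ^ i.+1 * b (M - i.+1)%nat).
  rewrite big_ord_recl /= subn0 Cmult_1_r big_distrr /=; congr Cplus.
  by apply: eq_bigr => i _; rewrite /bump leq0n add0n add1n; ring.
have Hsplit N (u v : nat -> C) (w : nat -> C) :
   \Csum_(i < N) ((u i + v i) * w i) = \Csum_(i < N) (u i * w i) + \Csum_(i < N) (v i * w i).
  by rewrite -big_split; apply: eq_bigr => i _; rewrite Cmult_plus_distr_r.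
rewrite hb (Hsplit _ (fun i => p i.+1) (fun i => x ^ i.+1) (fun i => b (M - i)%nat)).
rewrite Hp Hx.
(* The two sums multiplied by [x] are Newton's identity for [b] at [M], so they add up to
   [x * (M * b M)]; the separate [x * b M] completes the factor [M + 1]. *)
have := hb M; rewrite (Hsplit _ (fun i => p i.+1) (fun i => x ^ i.+1) (fun i => b (M - i.+1)%nat)).
rewrite RtoC_INR_S => E.
transitivity ((RtoC (INR M) + 1) * a M.+1 + x * b M + x * (RtoC (INR M) * b M)); last by ring.
by rewrite E; ring.
Qed.

Lemma partition_sum_shiftS n m M : m + RtoC (INR n.+1) <> 0 ->
  partition_sum M.+1 (shifted_power_sum n.+1 m)
  = partition_sum M.+1 (shifted_power_sum n m)
    + 1 / (m + RtoC (INR n.+1)) * partition_sum M (shifted_power_sum n.+1 m).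
Proof.
move=> hm; apply: (newton_add (shifted_power_sum n m)
          (fun M => partition_sum M (shifted_power_sum n m))
          (fun M => partition_sum M (shifted_power_sum n.+1 m))) => [|N|N].
- by rewrite !partition_sum0.
- exact: partition_sum_newton.
rewrite partition_sum_newton; apply: eq_bigr => i _.
by rewrite /shifted_power_sum big_ord_recr /Cdiv !Cmult_1_l Cpow_inv.
Qed.

(** * Limits and infinite products of complex numbers *)

(** Componentwise, to match [CLim_seq], whose value alone does not assert convergence. *)
Definition is_Clim (u : nat -> C) (l : C) : Prop :=
  is_lim_seq (fun k => fst (u k)) (fst l) /\ is_lim_seq (fun k => snd (u k)) (snd l).

Lemma is_Clim_unique u l : is_Clim u l -> CLim_seq u = l.
Proof.
move=> [h1 h2]; rewrite /CLim_seq (is_lim_seq_unique _ _ h1) (is_lim_seq_unique _ _ h2).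
by case: l {h1 h2}.
Qed.

Lemma is_Clim_fun u l l' : is_Clim u l -> is_Clim u l' -> l = l'.
Proof. by move=> /is_Clim_unique <- /is_Clim_unique <-. Qed.

Lemma is_Clim_const c : is_Clim (fun => c) c.
Proof. split; exact: is_lim_seq_const. Qed.

Lemma is_Clim_ext u v l : (forall k, u k = v k) -> is_Clim u l -> is_Clim v l.
Proof.
by move=> h [h1 h2]; split; [apply: is_lim_seq_ext h1 | apply: is_lim_seq_ext h2] => k;
  rewrite h.
Qed.

Lemma is_Clim_mult u v a b : is_Clim u a -> is_Clim v b ->
  is_Clim (fun k => u k * v k) (a * b).
Proof.
move=> [u1 u2] [v1 v2]; split => /=.
  by apply: is_lim_seq_minus'; apply: is_lim_seq_mult'.
by apply: is_lim_seq_plus'; apply: is_lim_seq_mult'.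
Qed.

Lemma is_Clim_incr_n u N l : is_Clim u l <-> is_Clim (fun k => u (k + N)%nat) l.
Proof.
by split=> -[h1 h2]; split;
  [apply/(is_lim_seq_incr_n (fun k => fst (u k))) | apply/(is_lim_seq_incr_n (fun k => snd (u k)))
  |apply/(is_lim_seq_incr_n (fun k => fst (u k)) N) | apply/(is_lim_seq_incr_n (fun k => snd (u k)) N)].
Qed.

Lemma ex_series_increments_lim (w : nat -> R) :
  ex_series (fun k => w k.+1 - w k)%R -> exists l : R, is_lim_seq w l.
Proof.
move=> [s hs]; exists (s + w 0%nat)%R; apply/is_lim_seq_incr_1.
apply: (is_lim_seq_ext (fun n => sum_n (fun k => w k.+1 - w k) n + w 0%nat)%R).
  by elim=> [|n IH]; rewrite ?sum_O ?sum_Sn /plus /=; lra.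
by apply: is_lim_seq_plus' => //; exact: is_lim_seq_const.
Qed.

(** Since [1 + t <= exp t], the partial products stay below the constant [B]; the increments
    [w k * b k] are then absolutely summable and [w] telescopes to a limit. *)
Lemma product_converges (w b : nat -> C) :
  (forall k, w k.+1 = w k * (1 + b k)) -> ex_series (fun k => Cmod (b k)) ->
  exists l, is_Clim w l.
Proof.
move=> hw hb.
pose B := (Cmod (w 0%nat) * exp (Series (fun k => Cmod (b k))))%R.
have step n : (Cmod (w n.+1) <= Cmod (w n) * exp (Cmod (b n)))%R.
  rewrite hw Cmod_mult; apply: Rmult_le_compat_l; first exact: Cmod_ge_0.
  apply: Rle_trans (Cmod_triangle _ _) _; rewrite Cmod_1.
  exact: exp_ineq1_le.
have hpart k : (Cmod (w k.+1) <= Cmod (w 0%nat) * exp (sum_n (fun k => Cmod (b k)) k))%R.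
  elim: k => [|k IH]; first by rewrite sum_O.
  apply: Rle_trans (step _) _; rewrite sum_Sn /plus /= exp_plus -Rmult_assoc.
  apply: Rmult_le_compat_r => //; apply: Rlt_le; exact: exp_pos.
have hS n : (sum_n (fun k => Cmod (b k)) n <= Series (fun k => Cmod (b k)))%R.
  apply: (is_lim_seq_incr_compare _ _ (Series_correct _ hb)) => {}n.
  by rewrite sum_Sn /plus /=; have := Cmod_ge_0 (b n.+1); lra.
have hE r : (r <= Series (fun k => Cmod (b k)))%R -> (Cmod (w 0%nat) * exp r <= B)%R.
  move=> hr; apply: Rmult_le_compat_l; first exact: Cmod_ge_0.
  by case: hr => [/exp_increasing|->]; lra.
have hB k : (Cmod (w k) <= B)%R.
  case: k => [|k]; last exact: Rle_trans (hpart k) (hE _ (hS k)).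
  rewrite -[X in (X <= _)%R]Rmult_1_r -exp_0; apply: hE; apply: Rle_trans (hS 0%nat).
  by rewrite sum_O; exact: Cmod_ge_0.
have hd k : (Cmod (w k.+1 - w k) <= B * Cmod (b k))%R.
  rewrite hw (_ : _ - _ = w k * b k); last by ring.
  by rewrite Cmod_mult; apply: Rmult_le_compat_r => //; exact: Cmod_ge_0.
have hBb : ex_series (fun k => B * Cmod (b k))%R by exact: (ex_series_scal_l B).
have [l1 h1] : exists l : R, is_lim_seq (fun k => fst (w k)) l.
  apply: ex_series_increments_lim; apply: (@ex_series_le R_AbsRing R_CompleteNormedModule) hBb => k.
  exact: Rle_trans (re_le_Cmod (w k.+1 - w k)) (hd k).
have [l2 h2] : exists l : R, is_lim_seq (fun k => snd (w k)) l.
  apply: ex_series_increments_lim; apply: (@ex_series_le R_AbsRing R_CompleteNormedModule) hBb => k.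
  apply: Rle_trans (hd k); apply: Rle_trans (Rmax_Cmod (w k.+1 - w k)).
  exact: Rmax_r.
by exists (l1, l2).
Qed.

(** The reciprocals form a product of the same kind, with factors [1 + b'] and [|b'| <= 2 |b|] as
    soon as [|b| <= 1/2]. Both [w] and [/ w] then converge, and their limits multiply to 1. *)
Lemma inv_product_converges (w b : nat -> C) :
  (forall k, w k <> 0) -> (forall k, w k.+1 = w k * (1 + b k)) ->
  ex_series (fun k => Cmod (b k)) ->
  exists2 l : C, l <> 0 & is_Clim (fun k => / w k) l.
Proof.
move=> hw0 hw hb.
have hb0 k : 1 + b k <> 0 by move=> h; apply: (hw0 k.+1); rewrite hw h; ring.
have [N hN] : exists N, forall k, (N <= k)%nat -> (Cmod (b k) <= / 2)%R.
  have h2 : (0 < / 2)%R by lra.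
  have [N hN] := proj2 (is_lim_seq_spec _ _) (ex_series_lim_0 _ hb) (mkposreal _ h2).
  exists N => k /leP hk; have := hN k hk; rewrite /= Rminus_0_r.
  by rewrite Rabs_pos_eq; [lra | exact: Cmod_ge_0].
(* Chosen so that [1 + b' k] is the inverse of [1 + b (k + N)]. *)
pose b' k := - b (k + N)%nat / (1 + b (k + N)%nat).
have [l' hl'] : exists l, is_Clim (fun k => / w (k + N)%nat) l.
  apply: (product_converges _ b') => [k|].
    rewrite addSn hw /b'; field; split; [exact: hb0 | exact: hw0].
  apply: (@ex_series_le R_AbsRing R_CompleteNormedModule _
            (fun k => 2 * Cmod (b (k + N)%nat))%R) => [k|]; last first.
    apply: (ex_series_scal_l 2%R).
    apply: (ex_series_ext (fun k => Cmod (b (N + k)%coq_nat))).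
      by move=> k; rewrite plusE addnC.
    by apply/(ex_series_incr_n (fun k => Cmod (b k))).
  rewrite /norm /= /abs /= Rabs_pos_eq; last exact: Cmod_ge_0.
  rewrite /b' Cmod_div ?Cmod_opp //.
  have hk := hN _ (leq_addl k N); set c := b _ in hk *.
  have h1 : (/ 2 <= Cmod (1 + c))%R.
    have := Cmod_triangle (1 + c) (- c).
    rewrite (_ : 1 + c + - c = 1); last by ring.
    rewrite Cmod_opp Cmod_1; lra.
  rewrite /Rdiv Rmult_comm; apply: Rmult_le_compat_r; first exact: Cmod_ge_0.
  by rewrite -[X in (_ <= X)%R]Rinv_inv; apply: Rinv_le_contravar; lra.
have {}hl' := proj2 (is_Clim_incr_n (fun k => / w k) N l') hl'.
exists l' => // l0; have [l hl] := product_converges _ _ hw hb.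
have E := is_Clim_fun _ _ _ (is_Clim_const 1)
  (is_Clim_ext _ _ _ (fun k => Cinv_r _ (hw0 k)) (is_Clim_mult _ _ _ _ hl hl')).
have := C1_nz; rewrite E l0; case; ring.
Qed.

(** * Complex-valued functions of a real variable *)

Notation is_Cderive := (@is_derive R_AbsRing C_R_NormedModule).

(** Bridge to real calculus: the product rule and the rule for [Cexp] are proved on the two
    components. *)
Lemma is_Cderive_components (f : R -> C) x l :
  is_Cderive f x l <->
  is_derive (fun t => fst (f t)) x (fst l) /\ is_derive (fun t => snd (f t)) x (snd l).
Proof.
split=> [h|[h1 h2]].
  split.
    exact: (filterdiff_comp' f (@fst R R) x _ _ h (filterdiff_linear _ is_linear_fst)).
  exact: (filterdiff_comp' f (@snd R R) x _ _ h (filterdiff_linear _ is_linear_snd)).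
apply: (is_derive_ext (fun t => (fst (f t), snd (f t)))) => [t|]; first by case: (f t).
exact: (filterdiff_comp'_2 _ _ (@pair R R) x _ _ (@pair R R) h1 h2
          (filterdiff_ext_lin _ _ _ (filterdiff_ext _ _ _ (fun t => surjective_pairing t) (filterdiff_id _))
          (fun t => surjective_pairing t))).
Qed.

Lemma is_Cderive_eq (f : R -> C) x (l l' : C) : is_Cderive f x l -> l = l' -> is_Cderive f x l'.
Proof. by move=> h <-. Qed.

Lemma is_Cderive_ext (f g : R -> C) x (l : C) :
  (forall t, f t = g t) -> is_Cderive f x l -> is_Cderive g x l.
Proof. exact: is_derive_ext. Qed.

Lemma is_Cderive_plus (f g : R -> C) x l l' :
  is_Cderive f x l -> is_Cderive g x l' -> is_Cderive (fun t => f t + g t) x (l + l').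
Proof. exact: is_derive_plus. Qed.

Lemma is_Cderive_const c x : is_Cderive (fun => c) x (RtoC 0).
Proof. exact: is_derive_const. Qed.

Lemma is_Cderive_RtoC (f : R -> R) x l :
  is_derive f x l -> is_Cderive (fun t => RtoC (f t)) x (RtoC l).
Proof. by move=> h; apply/is_Cderive_components; split => //=; exact: is_derive_const. Qed.

Lemma is_Cderive_mult (f g : R -> C) x l l' :
  is_Cderive f x l -> is_Cderive g x l' ->
  is_Cderive (fun t => f t * g t) x (l * g x + f x * l').
Proof.
move=> /is_Cderive_components [f1 f2] /is_Cderive_components [g1 g2].
have hc : forall a b : R, mult a b = mult b a by exact: Rmult_comm.
apply/is_Cderive_components; split => /=.
  have := is_derive_minus _ _ _ _ _ (is_derive_mult _ _ _ _ _ f1 g1 hc)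
            (is_derive_mult _ _ _ _ _ f2 g2 hc).
  by congr is_derive; rewrite /minus /plus /opp /mult /=; ring.
have := is_derive_plus _ _ _ _ _ (is_derive_mult _ _ _ _ _ f1 g2 hc)
          (is_derive_mult _ _ _ _ _ f2 g1 hc).
by congr is_derive; rewrite /plus /mult /=; ring.
Qed.

Lemma is_Cderive_scal c (f : R -> C) x l :
  is_Cderive f x l -> is_Cderive (fun t => c * f t) x (c * l).
Proof.
move=> h; apply: is_Cderive_eq (is_Cderive_mult _ _ _ _ _ (is_Cderive_const c x) h) _.
ring.
Qed.

Lemma is_Cderive_sum n (f : nat -> R -> C) x (l : nat -> C) :
  (forall i, (i < n)%nat -> is_Cderive (f i) x (l i)) ->
  is_Cderive (fun t => \Csum_(i < n) f i t) x (\Csum_(i < n) l i).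
Proof.
elim: n => [|n IH] h.
  rewrite big_ord0; apply: (is_Cderive_ext (fun => RtoC 0)) => [t|]; first by rewrite big_ord0.
  exact: is_Cderive_const.
rewrite big_ord_recr /=.
apply: (is_Cderive_ext (fun t => \Csum_(i < n) f i t + f n t)) => [t|].
  by rewrite big_ord_recr.
apply: is_Cderive_plus; last exact: h.
by apply: IH => i hi; apply: h; rewrite ltnS ltnW.
Qed.

(** * The complex exponential and powers with complex exponent *)

Lemma Cexp_plus a b : Cexp (a + b) = Cexp a * Cexp b.
Proof.
by rewrite /Cexp /Cmult /= exp_plus cos_plus sin_plus; congr (_, _); ring.
Qed.

Lemma Cexp_0 : Cexp 0 = 1.
Proof. by rewrite /Cexp /= exp_0 cos_0 sin_0; congr (_, _); ring. Qed.

Lemma Cmod_Cexp z : Cmod (Cexp z) = exp (fst z).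
Proof.
rewrite /Cexp /Cmod /=.
have -> : forall e c s : R, (e * c * (e * c * 1) + e * s * (e * s * 1) = Rsqr e * (Rsqr s + Rsqr c))%R.
  by move=> e c s; rewrite /Rsqr; ring.
by rewrite sin2_cos2 Rmult_1_r sqrt_Rsqr //; apply: Rlt_le; exact: exp_pos.
Qed.

Lemma Cexp_neq0 z : Cexp z <> 0.
Proof. by move=> h; have := exp_pos (fst z); rewrite -Cmod_Cexp h Cmod_0; lra. Qed.

Lemma is_Cderive_Cexp (f : R -> C) x l :
  is_Cderive f x l -> is_Cderive (fun t => Cexp (f t)) x (l * Cexp (f x)).
Proof.
move=> /is_Cderive_components [f1 f2].
have hc : forall a b : R, mult a b = mult b a by exact: Rmult_comm.
have he := is_derive_comp _ _ _ _ _ (is_derive_exp _) f1.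
have hcos := is_derive_comp _ _ _ _ _ (is_derive_cos _) f2.
have hsin := is_derive_comp _ _ _ _ _ (is_derive_sin _) f2.
apply/is_Cderive_components; split => /=.
  have := is_derive_mult _ _ _ _ _ he hcos hc.
  by congr is_derive; rewrite /plus /mult /scal /= /mult /=; ring.
have := is_derive_mult _ _ _ _ _ he hsin hc.
by congr is_derive; rewrite /plus /mult /scal /= /mult /=; ring.
Qed.

Lemma Cpowr_plus x a b : Cpowr x (a + b) = Cpowr x a * Cpowr x b.
Proof. by rewrite /Cpowr Cmult_plus_distr_r Cexp_plus. Qed.

Lemma Cpowr_1 x : (0 < x)%R -> Cpowr x 1 = RtoC x.
Proof.
move=> hx; rewrite /Cpowr Cmult_1_l /Cexp /= cos_0 sin_0 exp_ln //.
by congr (_, _); ring.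
Qed.

Lemma is_Cderive_Cpowr z x : (0 < x)%R ->
  is_Cderive (fun t => Cpowr t z) x (z * Cpowr x (z - 1)).
Proof.
move=> hx.
apply: is_Cderive_eq (is_Cderive_Cexp _ _ _ (is_Cderive_scal z _ _ _
  (is_Cderive_RtoC _ _ _ (is_derive_ln x hx)))) _.
have hx0 : RtoC x <> 0 by move=> /RtoC_inj; lra.
have E : Cpowr x z = Cpowr x (z - 1) * RtoC x.
  by rewrite -(Cpowr_1 x hx) -Cpowr_plus; congr Cpowr; ring.
rewrite -/(Cpowr x z) E RtoC_inv; last lra.
by field.
Qed.

(** * The gamma function *)

(** Here [1 - t] lies in [[1/2, 3/2]], hence in [[1/2, 2]]. *)
Lemma abs_ln_one_minus t : (Rabs t <= / 2)%R -> (Rabs (ln (1 - t)) <= ln 2)%R.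
Proof.
move=> /Rabs_le_between ht; apply/Rabs_le_between; rewrite -ln_Rinv; last lra.
by split; apply: ln_le; lra.
Qed.

Lemma Cmod_le_components (c : C) B :
  (Rabs (fst c) <= B)%R -> (Rabs (snd c) <= B)%R -> (Cmod c <= 2 * B)%R.
Proof.
case: c => a b /= ha hb.
rewrite (_ : (a, b) = RtoC a + RtoC b * Ci); last first.
  by rewrite /Cplus /Cmult /=; congr (_, _); ring.
apply: Rle_trans (Cmod_triangle _ _) _.
by rewrite Cmod_mult !Cmod_R Cmod_Ci; lra.
Qed.

(* The derivative in [h] is [- z (1 + z) h (1 - h)^(z - 1)]: the first order
   terms cancel. *)
Lemma euler_factor_bound (z : C) : exists K : R, forall h : R, (0 <= h <= / 2)%R ->
  (Cmod ((1 + z * RtoC h) * Cexp (z * RtoC (ln (1 - h))) - 1) <= K * (h * h))%R.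
Proof.
pose E t := Cexp (z * RtoC (ln (1 - t))).
pose g t := (1 + z * RtoC t) * E t.
pose g' t := - (z * (1 + z)) * RtoC t * RtoC (/ (1 - t)) * E t.
have hg t : (Rabs t <= / 2)%R -> is_Cderive g t (g' t).
  move=> /Rabs_le_between ht.
  have h1 : is_derive (fun t => ln (1 - t)) t (- / (1 - t))%R.
    by auto_derive; [lra | field; lra].
  have h2 : is_Cderive (fun t => 1 + z * RtoC t) t (0 + z * RtoC 1).
    apply: is_Cderive_plus; first exact: is_Cderive_const.
    apply: is_Cderive_scal; apply: is_Cderive_RtoC; exact: is_derive_id.
  apply: is_Cderive_eq (is_Cderive_mult _ _ _ _ _ h2
    (is_Cderive_Cexp _ _ _ (is_Cderive_scal z _ _ _ (is_Cderive_RtoC _ _ _ h1)))) _.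
  rewrite -/(E t) /g' RtoC_opp RtoC_inv; last lra.
  rewrite RtoC_minus; field.
  by rewrite -RtoC_minus => /RtoC_inj; lra.
(* The factor 2 bounds [1 / (1 - t)] and the exponential bounds [|E t|], both for [|t| <= 1/2]. *)
pose M := (Cmod (z * (1 + z)) * 2 * exp (Rabs (fst z) * ln 2))%R.
have hg' t : (Rabs t <= / 2)%R -> (Cmod (g' t) <= M * Rabs t)%R.
  move=> ht; rewrite /g' !Cmod_mult Cmod_opp Cmod_mult -Cmod_mult !Cmod_R Cmod_Cexp.
  have hinv : (0 <= Rabs (/ (1 - t)) <= 2)%R.
    move/Rabs_le_between: ht => ht; split; first exact: Rabs_pos.
    rewrite Rabs_pos_eq; last by apply: Rlt_le; apply: Rinv_0_lt_compat; lra.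
    by rewrite -[X in (_ <= X)%R]Rinv_inv; apply: Rinv_le_contravar; lra.
  have hexp : (0 <= exp (fst (z * RtoC (ln (1 - t)))%C) <= exp (Rabs (fst z) * ln 2))%R.
    split; first by apply: Rlt_le; exact: exp_pos.
    have hle : (fst (z * RtoC (ln (1 - t)))%C <= Rabs (fst z) * ln 2)%R.
      rewrite /= Rmult_0_r Rminus_0_r.
      apply: Rle_trans (Rle_abs _) _; rewrite Rabs_mult.
      apply: Rmult_le_compat_l; [exact: Rabs_pos | exact: abs_ln_one_minus].
    by case: hle => [/exp_increasing|->]; lra.
  have hA := Cmod_ge_0 (z * (1 + z)); have hP := Rabs_pos t.
  have hAP := Rmult_le_pos _ _ hA hP.
  have hQX := Rmult_le_compat _ _ _ _ (proj1 hinv) (proj1 hexp) (proj2 hinv) (proj2 hexp).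
  have := Rmult_le_compat_l _ _ _ hAP hQX.
  by rewrite /M; lra.
(* The mean value inequality applies to real functions, so it is used on each component; recombining
   them costs the factor 2. *)
exists (2 * M)%R => h hh.
have hM : (0 <= M)%R.
  rewrite /M; apply: Rmult_le_pos; last by apply: Rlt_le; exact: exp_pos.
  by have := Cmod_ge_0 (z * (1 + z)); lra.
have E0 : g 0%R = 1.
  by rewrite /g /E Rminus_0_r ln_1 !Cmult_0_r Cexp_0; ring.
(* [bounded_variation] asks for control on the interval symmetric about 0, so negative [t] occur
   too. *)
have hvar t : (Rabs (t - 0) <= Rabs (h - 0))%R ->
    is_Cderive g t (g' t) /\ (Cmod (g' t) <= M * h)%R.
  rewrite !Rminus_0_r (Rabs_pos_eq h); last lra.
  move=> ht; have ht2 : (Rabs t <= / 2)%R by lra.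
  split; first exact: hg.
  by apply: Rle_trans (hg' _ ht2) _; apply: Rmult_le_compat_l.
have Ehh : (M * (h * h) = M * h * Rabs (h - 0))%R.
  by rewrite Rminus_0_r Rabs_pos_eq; [ring | lra].
rewrite -/(E h) -/(g h) -E0 Rmult_assoc; apply: Cmod_le_components; rewrite Ehh.
  apply: (bounded_variation (fun t => fst (g t)) (fun t => fst (g' t))) => t /hvar [h1 h2].
  split; first by case/is_Cderive_components: h1.
  exact: Rle_trans (re_le_Cmod _) h2.
apply: (bounded_variation (fun t => snd (g t)) (fun t => snd (g' t))) => t /hvar [h1 h2].
split; first by case/is_Cderive_components: h1.
exact: Rle_trans (Rmax_r _ _) (Rle_trans _ _ _ (Rmax_Cmod _) h2).
Qed.

(** Comparison with the telescoping series of [1/(k+1) - 1/(k+2) = 1/((k+1)(k+2))], whose partial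
    sums are [1 - 1/(n+2)]. *)
Lemma ex_series_inv_sqr : ex_series (fun k => / INR k.+2 * / INR k.+2)%R.
Proof.
apply: (@ex_series_le R_AbsRing R_CompleteNormedModule _
          (fun k => / INR k.+1 - / INR k.+2)%R) => [k|].
  have h0 := pos_INR k; rewrite !S_INR /norm /= /abs /= Rabs_pos_eq.
    have -> : (/ (INR k + 1) - / (INR k + 1 + 1) = / (INR k + 1) * / (INR k + 1 + 1))%R.
      by field; lra.
    apply: Rmult_le_compat_r; last by apply: Rinv_le_contravar; lra.
    by apply: Rlt_le; apply: Rinv_0_lt_compat; lra.
  by apply: Rlt_le; apply: Rmult_lt_0_compat; apply: Rinv_0_lt_compat; lra.
exists (1 - 0)%R;
  change (is_lim_seq (sum_n (fun k => / INR k.+1 - / INR k.+2)%R) (1 - 0)%R).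
apply: (is_lim_seq_ext (fun n => 1 - / INR n.+2)%R).
  elim=> [|n IH]; first by rewrite sum_O /=; lra.
  by rewrite sum_Sn -IH /plus /=; lra.
apply: is_lim_seq_minus'; first exact: is_lim_seq_const.
apply: (is_lim_seq_inv _ p_infty) => //.
by apply/(is_lim_seq_incr_1 (fun k => INR k.+1)); apply/(is_lim_seq_incr_1 INR); exact: is_lim_seq_INR.
Qed.

Definition euler_term (z : C) (k : nat) : C :=
  RtoC (INR (fact k)) * Cpowr (INR k) z / \Cprod_(j < k.+1) (z + RtoC (INR j)).

Lemma big_Cmult_neq0 n (f : nat -> C) : (forall j, (j < n)%nat -> f j <> 0) ->
  \Cprod_(j < n) f j <> 0.
Proof.
elim: n => [|n IH] h; first by rewrite big_ord0; exact: C1_nz.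
rewrite big_ord_recr /=; apply: Cmult_neq_0; last exact: h.
by apply: IH => j hj; apply: h; rewrite ltnS ltnW.
Qed.

(** The inverses [w] of the Euler terms satisfy [w k.+1 = w k * (1 + b k)] with [b k] of order
    [1/(k+2)^2], so [inv_product_converges] applies. *)
Lemma euler_term_lim (z : C) : (forall j : nat, z + RtoC (INR j) <> 0) ->
  Gamma z <> 0 /\ is_Clim (euler_term z) (Gamma z).
Proof.
move=> hz.
have [K hK] := euler_factor_bound z.
(* Starting at index 1 keeps the base of the power positive and makes [h k <= 1/2], as
   [euler_factor_bound] requires. *)
pose w k := \Cprod_(j < k.+2) (z + RtoC (INR j)) / (RtoC (INR (fact k.+1)) * Cpowr (INR k.+1) z).
pose h k := (/ INR k.+2)%R.
pose b k := (1 + z * RtoC (h k)) * Cexp (z * RtoC (ln (1 - h k))) - 1.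
have hprod n : \Cprod_(j < n) (z + RtoC (INR j)) <> 0 by exact: (big_Cmult_neq0 _ (fun j => z + RtoC (INR j))).
have hpow k : Cpowr (INR k) z <> 0 by exact: Cexp_neq0.
have hw0 k : w k <> 0.
  move=> E; apply: (hprod k.+2).
  have -> : \Cprod_(j < k.+2) (z + RtoC (INR j)) = w k * (RtoC (INR (fact k.+1)) * Cpowr (INR k.+1) z).
    have h1 := hpow k.+1; have h2 := fact_INR_neq0 k.+1.
    by rewrite /w; field.
  by rewrite E Cmult_0_l.
(* The ratio of consecutive terms is [(z + k + 2)/(k + 2)] times [((k + 1)/(k + 2))^z], that is
   [(1 + z h) (1 - h)^z]. *)
have hw k : w k.+1 = w k * (1 + b k).
  have hpos : (0 < INR k.+1)%R by apply: lt_0_INR; exact/ltP.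
  have Eh : (1 - h k = INR k.+1 / INR k.+2)%R by rewrite /h (S_INR k.+1); field; lra.
  have EP : Cpowr (INR k.+1) z = Cpowr (INR k.+2) z * Cexp (z * RtoC (ln (1 - h k))).
    rewrite /Cpowr -Cexp_plus -Cmult_plus_distr_l -RtoC_plus Eh; congr (Cexp (z * RtoC _)).
    by rewrite ln_div ?[INR k.+2]S_INR; lra.
  have Ep : \Cprod_(j < k.+3) (z + RtoC (INR j))
      = \Cprod_(j < k.+2) (z + RtoC (INR j)) * (z + RtoC (INR k.+2)) by rewrite big_ord_recr.
  rewrite /w Ep EP /b.
  have -> : fact k.+2 = (k.+2 * fact k.+1)%coq_nat by [].
  rewrite mult_INR RtoC_mult /h RtoC_inv; last by rewrite S_INR; lra.
  have h1 := hpow k.+2; have h2 := fact_INR_neq0 k.+1; have h3 := RtoC_INR_neq0 k.+1.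
  have h4 := Cexp_neq0 (z * RtoC (ln (1 - / INR k.+2))).
  by field.
have hb : ex_series (fun k => Cmod (b k)).
  apply: (@ex_series_le R_AbsRing R_CompleteNormedModule _ (fun k => K * (h k * h k))%R) => [k|].
    rewrite /norm /= /abs /= Rabs_pos_eq; last exact: Cmod_ge_0.
    apply: hK; rewrite /h; have h0 := pos_INR k; rewrite !S_INR; split.
      by apply: Rlt_le; apply: Rinv_0_lt_compat; lra.
    by apply: Rinv_le_contravar; lra.
  exact: (ex_series_scal_l K _ ex_series_inv_sqr).
have [l hl0 hl] := inv_product_converges _ _ hw0 hw hb.
have {}hl : is_Clim (euler_term z) l.
  apply/(is_Clim_incr_n _ 1); apply: is_Clim_ext hl => k.
  rewrite addn1 /w /euler_term.
  have h1 := hpow k.+1; have h2 := fact_INR_neq0 k.+1; have h3 := hprod k.+2.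
  by field.
by rewrite /Gamma (is_Clim_unique _ _ hl).
Qed.

(** For [k > 0], the Euler term of [z + 1] times [1 + (z + 1)/k] equals [z] times the Euler term of
    [z]; the correction factor tends to 1. *)
Lemma Gamma_succ (z : C) : (forall j : nat, z + RtoC (INR j) <> 0) ->
  Gamma (z + 1) = z * Gamma z.
Proof.
move=> hz.
have hz1 j : z + 1 + RtoC (INR j) <> 0.
  by have := hz j.+1; rewrite RtoC_INR_S; congr (_ <> _); ring.
have [_ h1] := euler_term_lim _ hz1; have [_ h0] := euler_term_lim _ hz.
pose t k := 1 + (z + 1) * RtoC (/ INR k.+1).
have ht : is_Clim t 1.
  have hinv : is_lim_seq (fun k => / INR k.+1)%R 0.
    apply: (is_lim_seq_inv _ p_infty) => //.
    by apply/(is_lim_seq_incr_1 INR); exact: is_lim_seq_INR.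
  have hc : is_Clim (fun k => RtoC (/ INR k.+1)) 0.
    by split => //=; exact: is_lim_seq_const.
  have [h2 h3] := is_Clim_mult _ _ _ _ (is_Clim_const (z + 1)) hc.
  split.
    have -> : fst (RtoC 1) = (fst (RtoC 1) + fst ((z + 1) * 0)%C)%R by rewrite Cmult_0_r /=; ring.
    by apply: is_lim_seq_plus' => //; exact: is_lim_seq_const.
  have -> : snd (RtoC 1) = (snd (RtoC 1) + snd ((z + 1) * 0)%C)%R by rewrite Cmult_0_r /=; ring.
  by apply: is_lim_seq_plus' => //; exact: is_lim_seq_const.
have {}h1 := proj1 (is_Clim_incr_n _ 1 _) h1.
have {}h0 := proj1 (is_Clim_incr_n _ 1 _) h0.
rewrite -[LHS]Cmult_1_r.
apply: is_Clim_fun (is_Clim_mult _ _ _ _ h1 ht) _.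
apply: is_Clim_ext (is_Clim_mult _ _ _ _ (is_Clim_const z) h0) => k.
rewrite addn1 /euler_term /t.
have -> : \Cprod_(j < k.+2) (z + 1 + RtoC (INR j))
    = \Cprod_(j < k.+1) (z + RtoC (INR j.+1)) * (z + 1 + RtoC (INR k.+1)).
  rewrite big_ord_recr; congr (_ * _); apply: eq_bigr => j _.
  by rewrite RtoC_INR_S /=; ring.
rewrite big_ord_recl.
rewrite Cpowr_plus Cpowr_1; last by apply: lt_0_INR; exact/ltP.
have h2 : \Cprod_(j < k.+1) (z + RtoC (INR j.+1)) <> 0.
  by apply: (big_Cmult_neq0 _ (fun j => z + RtoC (INR j.+1))).
have h3 := hz 0%nat; have h4 := hz1 k.+1.
have h5 := RtoC_INR_neq0 k.
rewrite RtoC_inv; last by move=> E; apply: h5; rewrite E.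
rewrite Cplus_0_r in h3 *.
have -> : \Cprod_(j < k.+1) (z + RtoC (INR (lift ord0 j))) = \Cprod_(j < k.+1) (z + RtoC (INR j.+1)).
  by [].
by field.
Qed.

Lemma Gamma_shift (m : C) n : (forall j : nat, m + RtoC (INR j.+1) <> 0) ->
  Gamma (RtoC (INR n) + m + 1) = Gamma (m + 1) * \Cprod_(r < n) (m + RtoC (INR r.+1)).
Proof.
move=> hm; elim: n => [|n IH].
  by rewrite big_ord0 Cmult_1_r Cplus_0_l.
rewrite big_ord_recr /= Cmult_assoc -IH.
rewrite (_ : RtoC (INR n.+1) + m + 1 = RtoC (INR n) + m + 1 + 1); last first.
  by rewrite RtoC_INR_S; ring.
rewrite Gamma_succ => [|j]; first by rewrite RtoC_INR_S; ring.
have := hm (n + j)%nat; rewrite RtoC_INR_S plus_INR RtoC_plus.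
by congr (_ <> _); ring.
Qed.

(** * Iterated primitives *)

(** Serves twice: [f] is the identity for the integration constants and [ln] for the powers of the
    logarithm. Dividing by factorials turns differentiation into an index shift. *)
Lemma is_Cderive_divided_power (f : R -> R) x l k : is_derive f x l ->
  is_Cderive (fun t => RtoC (f t) ^ k.+1 / RtoC (INR (fact k.+1))) x
    (RtoC l * (RtoC (f x) ^ k / RtoC (INR (fact k)))).
Proof.
move=> /is_Cderive_RtoC hf.
have hpow : is_Cderive (fun t => RtoC (f t) ^ k.+1) x
              (RtoC (INR k.+1) * RtoC (f x) ^ k * RtoC l).
  elim: k => [|k IH].
    by apply: is_Cderive_eq (is_Cderive_ext _ _ _ _ (fun t => esym (Cpow_1_r _)) hf) _ => /=; ring.
  apply: is_Cderive_eq (is_Cderive_mult _ _ _ _ _ hf IH) _.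
  by rewrite (RtoC_INR_S k.+1) /=; ring.
apply: is_Cderive_ext (fun t => Cmult_comm _ _) _.
apply: is_Cderive_eq (is_Cderive_scal (/ RtoC (INR (fact k.+1))) _ _ _ hpow) _.
have -> : fact k.+1 = (k.+1 * fact k)%coq_nat by [].
rewrite mult_INR RtoC_mult.
have h1 := RtoC_INR_neq0 k; have h2 := fact_INR_neq0 k.
by field.
Qed.

Definition taylor_sum (c : nat -> C) n x :=
  \Csum_(i < n) (c i * (RtoC x ^ i / RtoC (INR (fact i)))).

Lemma taylor_sum_recl c n x :
  taylor_sum c n.+1 x
  = c 0%nat + \Csum_(i < n) (c i.+1 * (RtoC x ^ i.+1 / RtoC (INR (fact i.+1)))).
Proof.
rewrite /taylor_sum big_ord_recl; congr (_ + _).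
by rewrite /=; field.
Qed.

Lemma is_Cderive_taylor_sum c n x :
  is_Cderive (taylor_sum c n.+1) x (taylor_sum (fun i => c i.+1) n x).
Proof.
apply: is_Cderive_ext (fun t => esym (taylor_sum_recl c n t)) _.
apply: is_Cderive_eq (is_Cderive_plus _ _ _ _ _ (is_Cderive_const _ _)
  (is_Cderive_sum _ (fun i t => c i.+1 * (RtoC t ^ i.+1 / RtoC (INR (fact i.+1)))) _
    (fun i => c i.+1 * (RtoC x ^ i / RtoC (INR (fact i)))) _)) _.
  move=> i _; apply: is_Cderive_scal.
  apply: is_Cderive_eq (is_Cderive_divided_power _ _ _ _ (is_derive_id x)) _.
  exact: Cmult_1_l.
exact: Cplus_0_l.
Qed.

Lemma is_Cderive0_const (f : R -> C) :
  (forall x, (0 < x)%R -> is_Cderive f x (RtoC 0)) ->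
  forall x, (0 < x)%R -> f x = f 1%R.
Proof.
move=> hf x hx.
have key a b : (0 < a)%R -> (a < b)%R -> f a = f b.
  move=> ha; apply: (@eq_is_derive C_R_NormedModule f) => t ht.
  by apply: hf; lra.
case: (Rtotal_order x 1) => [h|[->|h]] //; first exact: key.
by apply/esym/key; lra.
Qed.

Lemma is_Cderive_ext_pos (f g : R -> C) x (l : C) : (0 < x)%R ->
  (forall t, (0 < t)%R -> f t = g t) -> is_Cderive f x l -> is_Cderive g x l.
Proof.
move=> hx h; apply: is_derive_ext_loc.
exact: filter_imp h (open_gt 0%R x hx).
Qed.

(** Induction on [n]: each integration adds one constant, and the earlier constants move up one
    index. *)
Lemma nth_derive_pos_primitives (g : R -> C) (G : nat -> R -> C) :
  (forall x, (0 < x)%R -> G 0%nat x = g x) ->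
  (forall n x, (0 < x)%R -> is_Cderive (G n.+1) x (G n x)) ->
  forall n F, is_nth_derive_pos n F g <->
    exists c : nat -> C, forall x, (0 < x)%R -> F x = G n x + taylor_sum c n x.
Proof.
move=> hG0 hG; elim=> [|n IH] F /=.
  split=> [h|[c h] x hx].
    exists (fun => RtoC 0) => x hx; rewrite h // hG0 //.
    by rewrite /taylor_sum big_ord0 Cplus_0_r.
  by rewrite h // hG0 // /taylor_sum big_ord0 Cplus_0_r.
split=> [[F' [hF /IH [c hF']]]|[c hF]].
  (* [d a] prepends a new constant [a] to [c]. With [a = 0] the difference [D] has zero derivative,
     and its value at 1 is the constant to prepend. *)
  pose d (a : C) i := if i is j.+1 then c j else a.
  pose D x := F x + - (1) * (G n.+1 x + taylor_sum (d 0) n.+1 x).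
  have hD x : (0 < x)%R -> is_Cderive D x (RtoC 0).
    move=> hx; apply: is_Cderive_eq (is_Cderive_plus _ _ _ _ _ (hF x hx)
      (is_Cderive_scal _ _ _ _ (is_Cderive_plus _ _ _ _ _ (hG n x hx)
         (is_Cderive_taylor_sum (d 0) n x)))) _.
    rewrite hF' //; change (taylor_sum (fun i => d 0 i.+1) n x) with (taylor_sum c n x).
    ring.
  exists (d (D 1%R)) => x hx.
  have := is_Cderive0_const D hD x hx.
  rewrite {1}/D taylor_sum_recl => E.
  by rewrite taylor_sum_recl -E /=; ring.
exists (fun x => G n x + taylor_sum (fun i => c i.+1) n x); split; last first.
  by apply/IH; exists (fun i => c i.+1).
move=> x hx; apply: (is_Cderive_ext_pos (fun x => G n.+1 x + taylor_sum c n.+1 x)) => //.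
  by move=> t ht; rewrite hF.
by apply: is_Cderive_plus; [exact: hG | exact: is_Cderive_taylor_sum].
Qed.

(** * The explicit primitives of [x^m (ln x)^m'] *)

Definition log_coeff (m : C) m' n k :=
  RtoC (-1) ^ (m' - k)%nat * partition_sum (m' - k) (shifted_power_sum n m).

Definition log_sum (m : C) m' n x :=
  \Csum_(k < m'.+1) (log_coeff m m' n k * (RtoC (ln x) ^ k / RtoC (INR (fact k)))).

(** The closed form without integration constants, with the gamma quotient already replaced by a
    finite product. *)
Definition power_log_primitive (m : C) m' n x :=
  RtoC (INR (fact m')) / \Cprod_(r < n) (m + RtoC (INR r.+1))
  * Cpowr x (RtoC (INR n) + m) * log_sum m m' n x.

(** For [n = 0] all power sums vanish; Newton's identities then kill the partition sums of positive
    integers, and only [k = m'] survives. *)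
Lemma power_log_primitive0 m m' x :
  power_log_primitive m m' 0 x = Cpowr x m * RtoC (ln x) ^ m'.
Proof.
rewrite /power_log_primitive /log_sum big_ord0 Cplus_0_l big_ord_recr big1 /= => [|k _].
  rewrite /log_coeff subnn partition_sum0 /=.
  by have h := fact_INR_neq0 m'; field.
rewrite /log_coeff.
have /ltnW := ltn_ord k; have := ltn_ord k; rewrite -subn_gt0.
case: (m' - k)%nat => // N _ _.
suff -> : partition_sum N.+1 (shifted_power_sum 0 m) = 0 by ring.
have hN := RtoC_INR_neq0 N.
have : RtoC (INR N.+1) * partition_sum N.+1 (shifted_power_sum 0 m) = 0.
  rewrite partition_sum_newton big1 // => i _.
  by rewrite /shifted_power_sum big_ord0 Cmult_0_l.
move=> E; have -> : partition_sum N.+1 (shifted_power_sum 0 m)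
  = / RtoC (INR N.+1) * (RtoC (INR N.+1) * partition_sum N.+1 (shifted_power_sum 0 m)) by field.
by rewrite E; ring.
Qed.

(** With [a = m + n + 1] and [L_n] for the sum at [n], this reads [a L_n = a L_{n+1} + x L_{n+1}'],
    which is what differentiating [x^a L_{n+1}] requires. Coefficientwise it is
    [partition_sum_shiftS], the sign coming from the powers of -1. *)
Lemma log_sum_step (m : C) m' n x : m + RtoC (INR n.+1) <> 0 ->
  (m + RtoC (INR n.+1)) * log_sum m m' n x
  = (m + RtoC (INR n.+1)) * log_sum m m' n.+1 x
    + \Csum_(k < m') (log_coeff m m' n.+1 k.+1 * (RtoC (ln x) ^ k / RtoC (INR (fact k)))).
Proof.
move=> hm; set a := m + _ in hm *.
rewrite /log_sum !big_ord_recr /= !Cmult_plus_distr_l !big_distrr /=.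
rewrite [RHS](_ : forall u v w, u + v + w = u + w + v) => [|*]; last by ring.
rewrite -big_split /=; congr (_ + _); last by rewrite /log_coeff subnn !partition_sum0.
apply: eq_bigr => k _; rewrite /log_coeff.
have -> : (m' - k = (m' - k.+1).+1)%nat by rewrite subnSK.
have hk := fact_INR_neq0 k.
by rewrite partition_sum_shiftS // -/a Cpow_S; field.
Qed.

Lemma is_Cderive_power_log_primitive (m : C) m' n x :
  (forall j : nat, m + RtoC (INR j.+1) <> 0) -> (0 < x)%R ->
  is_Cderive (power_log_primitive m m' n.+1) x (power_log_primitive m m' n x).
Proof.
move=> hm hx.
pose T := \Csum_(k < m') (log_coeff m m' n.+1 k.+1 * (RtoC (ln x) ^ k / RtoC (INR (fact k)))).
(* The term [k = 0] is constant; the others lose one power of [ln] and gain [1/x]. *)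
have hS : is_Cderive (log_sum m m' n.+1) x (RtoC (/ x) * T).
  apply: (is_Cderive_ext (fun t => log_coeff m m' n.+1 0 * 1
    + \Csum_(k < m') (log_coeff m m' n.+1 k.+1 * (RtoC (ln t) ^ k.+1 / RtoC (INR (fact k.+1)))))).
    move=> t; rewrite /log_sum big_ord_recl; congr (_ * _ + _).
    by rewrite /=; field.
  apply: is_Cderive_eq (is_Cderive_plus _ _ _ _ _ (is_Cderive_const _ _)
    (is_Cderive_sum _ (fun k t => log_coeff m m' n.+1 k.+1 * (RtoC (ln t) ^ k.+1 / RtoC (INR (fact k.+1)))) _
      (fun k => log_coeff m m' n.+1 k.+1 * (RtoC (/ x) * (RtoC (ln x) ^ k / RtoC (INR (fact k))))) _)) _.
    move=> k _; apply: is_Cderive_scal.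
    exact: is_Cderive_divided_power (is_derive_ln x hx).
  rewrite Cplus_0_l /T big_distrr /=; apply: eq_bigr => k _; ring.
apply: is_Cderive_eq (is_Cderive_mult _ _ _ _ _
  (is_Cderive_scal _ _ _ _ (is_Cderive_Cpowr (RtoC (INR n.+1) + m) x hx)) hS) _.
have hx0 : RtoC x <> 0 by move=> /RtoC_inj; lra.
rewrite /power_log_primitive.
have hprod := big_Cmult_neq0 n (fun r => m + RtoC (INR r.+1)) (fun j _ => hm j).
have -> : \Cprod_(r < n.+1) (m + RtoC (INR r.+1))
    = \Cprod_(r < n) (m + RtoC (INR r.+1)) * (m + RtoC (INR n.+1)) by rewrite big_ord_recr.
have E1 : RtoC (INR n.+1) + m - 1 = RtoC (INR n) + m by rewrite RtoC_INR_S; ring.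
have E2 : Cpowr x (RtoC (INR n.+1) + m) = Cpowr x (RtoC (INR n) + m) * RtoC x.
  by rewrite -(Cpowr_1 x hx) -Cpowr_plus; congr Cpowr; rewrite RtoC_INR_S; ring.
rewrite E1 E2 RtoC_inv; last lra.
have h := hm n; have hstep := log_sum_step m m' n x h.
(* Brings in the factor [m + n + 1], so that [log_sum_step] applies and the extra denominator of the
   product at [n.+1] cancels. *)
have -> : log_sum m m' n x = / (m + RtoC (INR n.+1)) * ((m + RtoC (INR n.+1)) * log_sum m m' n x).
  by field.
rewrite hstep -/T; field.
by [].
Qed.

Theorem theorem3p2 (m : C) (m' n : nat)
  (hm : forall j : nat, (1 <= j)%nat -> m <> RtoC (- INR j))
  (hn : (1 <= n)%nat) (F : R -> C) :
  is_nth_derive_pos n F (fun x : R => Cpowr x m * RtoC (ln x) ^ m')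
  <->
  exists c : nat -> C, forall x : R, (0 < x)%R ->
    F x =
      RtoC (INR (fact m')) * Gamma (m + 1) * Cpowr x (RtoC (INR n) + m)
        / Gamma (RtoC (INR n) + m + 1)
        * (\Csum_(k < m'.+1)
             (RtoC (-1) ^ (m' - k)%nat
              * (RtoC (ln x) ^ k / RtoC (INR (fact k)))
              * partition_sum (m' - k) (shifted_power_sum n m)))
      + \Csum_(i < n) (c i * (RtoC x ^ i / RtoC (INR (fact i)))).
Proof.
have hm0 j : m + RtoC (INR j.+1) <> 0.
  move=> E; apply: (hm j.+1) => //; rewrite RtoC_opp.
  by rewrite -[LHS]Cplus_0_r -(Cplus_opp_r (RtoC (INR j.+1))) Cplus_assoc E Cplus_0_l.
have hm1 j : m + 1 + RtoC (INR j) <> 0.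
  by have := hm0 j; rewrite RtoC_INR_S; congr (_ <> _); ring.
have [hGamma _] := euler_term_lim (m + 1) hm1.
have hprod := big_Cmult_neq0 n (fun r => m + RtoC (INR r.+1)) (fun j _ => hm0 j).
have E x : power_log_primitive m m' n x
    = RtoC (INR (fact m')) * Gamma (m + 1) * Cpowr x (RtoC (INR n) + m)
        / Gamma (RtoC (INR n) + m + 1)
        * (\Csum_(k < m'.+1)
             (RtoC (-1) ^ (m' - k)%nat
              * (RtoC (ln x) ^ k / RtoC (INR (fact k)))
              * partition_sum (m' - k) (shifted_power_sum n m))).
  (* Since [Gamma (m + 1)] is nonzero, it cancels and leaves the inverse of the finite product. *)
  rewrite /power_log_primitive Gamma_shift //; congr (_ * _); first by field.
  by apply: eq_bigr => k _; rewrite /log_coeff; ring.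
have [h1 h2] := nth_derive_pos_primitives _ (power_log_primitive m m')
  (fun x _ => power_log_primitive0 m m' x)
  (fun n x => is_Cderive_power_log_primitive m m' n x hm0) n F.
split=> [/h1 [c hc]|[c hc]]; last apply: h2; exists c => x hx.
  by rewrite hc // E.
by rewrite E; exact: hc.
Qed.
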